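(* Let $n \geq 1$ be an integer, let $X$ be the random walk on the complete graph with vertex set $\mathcal{X} = \{0,1,\ldots,n\}$, and let $\mu,\nu$ be probability distributions on $\mathcal{X}$. Then the optimal transport time $H(\mu,\nu)$ from $\mu$ to $\nu$ using $X$ satisfies $$H(\mu,\nu) = n \max_{j\in\{0,\ldots,n\}} (\nu_j - \mu_j).$$ In particular, for every $j \in \{0,\ldots,n\}$, $$n(\nu_j - \mu_j)_+ \leq H(\mu,\nu) \leq n\|\mu-\nu\|_{TV} \leq n = O(n).$$ Moreover, within the class of Dirac masses $\mathcal{P} := \{\delta_i : i \in \mathcal{X}\}$, the distribution minimizing $H(\cdot,\nu)$ is $\mu^* := \delta_{i^*}$, where $i^* \in \arg\max_{i} \nu_i$, i.e. $$\min_{\mu\in\mathcal{P}} H(\mu,\nu) = H(\mu^*,\nu).$$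
   Context: The random walk on the complete graph on $\{0,\ldots,n\}$ is the discrete-time Markov chain with $p_{i,i} = 0$ and $p_{i,j} = 1/n$ for $i \neq j$. For probability distributions $\mu,\nu$ on the state space, the optimal transport time (also called access time) is $H(\mu,\nu) := \inf_{T} \mathbb{E}[T]$, where $X_0 \sim \mu$ and the infimum is over all almost surely finite, possibly randomized, stopping times $T$ of $X$ such that $X_T \sim \nu$. (A randomized stopping time is a stopping time with respect to a filtration $\mathcal{F}_t = \sigma(U, X_0,\dots,X_t)$, where $U$ is uniform on $[0,1]$ and independent of $X$.) The total variation distance is $\|\mu-\nu\|_{TV} := \sup_{A\subset\mathcal{X}} |\mu(A)-\nu(A)| = \frac12\sum_{j}|\mu_j-\nu_j|$, $\delta_i$ is the Dirac mass at $i$, and $x_+ := \max\{x,0\}$. *)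

(* Defs.v *)
From HB Require Import structures.
From mathcomp Require Import all_boot all_order all_algebra.
From mathcomp Require Import all_classical all_reals all_analysis.

Set Implicit Arguments.
Unset Strict Implicit.
Unset Printing Implicit Defensive.

Import Order.TTheory GRing.Theory Num.Theory.
Import numFieldNormedType.Exports.

Local Open Scope classical_set_scope.
Local Open Scope ring_scope.

Definition is_distr (R : realType) (S : finType) (mu : S -> R) : Prop :=
  (forall i, 0 <= mu i) /\ \sum_i mu i = 1.

Definition dirac_mass (R : realType) (S : finType) (i : S) : S -> R :=
  fun j => (j == i)%:R.

Definition dirac_masses (R : realType) (S : finType) : set (S -> R) :=
  [set dirac_mass R i | i in [set: S]].

Arguments dirac_masses R S : clear implicits.

Definition tv_dist (R : realType) (S : finType) (mu nu : S -> R) : R :=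
  sup [set `|\sum_(i in A) mu i - \sum_(i in A) nu i| | A in [set: {set S}]].

Definition complete_walk (R : realType) (n : nat) (i j : 'I_n.+1) : R :=
  if i == j then 0 else n%:R^-1.

Section Chain.
Context d (Omega : measurableType d) (R : realType) (P : probability Omega R).
Variables (S : finType) (U : {RV P >-> R}) (X : nat -> Omega -> S).

(* The last clause is
   P(X_(t+1) = x_(t+1) | X_0 = x_0, ..., X_t = x_t) = p(x_t, x_(t+1))
   for every path of positive probability, with the conditional probability
   multiplied out. *)
Definition markov_chain (mu : S -> R) (p : S -> S -> R) : Prop :=
  [/\ forall t x, measurable (X t @^-1` [set x]),
      forall x, P (X 0%N @^-1` [set x]) = (mu x)%:E
    & forall (t : nat) (x : nat -> S),
        P [set w | forall s, (s <= t.+1)%N -> X s w = x s] =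
        (P [set w | forall s, (s <= t)%N -> X s w = x s] *
         (p (x t) (x t.+1))%:E)%E].

Definition uniform01 : Prop :=
  forall B : set R, measurable B -> P (U @^-1` B) = uniform_prob (@ltr01 R) B.

(* Generators of sigma(U) and sigma(X_s); S carries its discrete
   sigma-algebra. *)
Definition gen_U : set_system Omega := preimage_set_system setT U measurable.

Definition gen_X (s : nat) : set_system Omega :=
  preimage_set_system setT (X s) [set: set S].

Definition indep_UX : Prop :=
  forall A B : set Omega,
    <<s gen_U >> A -> <<s \bigcup_s gen_X s >> B ->
    P (A `&` B) = (P A * P B)%E.

Definition filtration (t : nat) : set_system Omega :=
  <<s gen_U `|` \bigcup_(s in [set s | (s <= t)%N]) gen_X s >>.

(* A random time takes values in nat plus infinity, encoded as [option nat]
   with [None] for infinity. *)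
Definition stopping_time (T : Omega -> option nat) : Prop :=
  forall t, filtration t [set w | exists2 s, (s <= t)%N & T w = Some s].

Definition as_finite (T : Omega -> option nat) : Prop :=
  {ae P, forall w, T w <> None}.

Definition stopped_law (T : Omega -> option nat) (nu : S -> R) : Prop :=
  forall x, P [set w | exists2 t, T w = Some t & X t w = x] = (nu x)%:E.

Definition expected_time (T : Omega -> option nat) : \bar R :=
  (\int[P]_w (if T w is Some t then t%:R%:E else +oo))%E.

End Chain.

(* [transport_cost p mu nu c]: c is the expectation of an almost surely finite
   randomized stopping time carrying mu to nu, on some probability space that
   supports a chain X with transitions p and initial law mu together with an
   independent uniform variable U. *)
Definition transport_cost (R : realType) (S : finType) (p : S -> S -> R)
    (mu nu : S -> R) (c : \bar R) : Prop :=
  exists (d : measure_display) (Omega : measurableType d)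
         (P : probability Omega R) (U : {RV P >-> R})
         (X : nat -> Omega -> S) (T : Omega -> option nat),
    [/\ markov_chain P X mu p, uniform01 U & indep_UX U X] /\
    [/\ stopping_time U X T, as_finite P T, stopped_law P X T nu
      & c = expected_time P T].

Definition access_time (R : realType) (S : finType) (p : S -> S -> R)
    (mu nu : S -> R) : \bar R :=
  ereal_inf [set c | transport_cost p mu nu c].

(* The maximum of [nu j - mu j] over all j; the default value of the iterated
   maximum is the term at j = 0, so it adds nothing to the range. *)
Definition max_excess (R : realType) (n : nat) (mu nu : 'I_n.+1 -> R) : R :=
  \big[Num.max/(nu ord0 - mu ord0)]_(j < n.+1) (nu j - mu j).

(* Main.v *)
Require Import Defs.
From HB Require Import structures.
From mathcomp Require Import all_boot all_order all_algebra.
From mathcomp Require Import all_classical all_reals all_analysis.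
From mathcomp Require Import measurable_realfun.
From mathcomp Require Import lra.

Import Order.TTheory GRing.Theory Num.Theory.
Import numFieldNormedType.Exports.

Local Open Scope classical_set_scope.
Local Open Scope ring_scope.

Set Implicit Arguments.
Unset Strict Implicit.
Unset Printing Implicit Defensive.

(** Lower bound.  The walk enters a state j with probability 1/n from any other
state and with probability 0 from j itself.  Hence the event that T is still
running at time t and the walk sits in j at time t+1 has probability at most
P(T > t)/n, whatever randomization T uses.  The walk can stop in j only by
starting there or by arriving there while T is running, so summing over t gives
nu_j <= mu_j + E[T]/n ([stopped_at_le], [walk_time_ge]).  Taking the maximum
over j bounds H(mu, nu) from below.

Equality.  Nothing is lost in this count when T never lets the walk be in j
without stopping ([stopped_at_eq]).  So, if j0 maximizes nu - mu, any
stopping time that carries mu to nu and always stops in j0 is optimal, and its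
expectation n (nu_j0 - mu_j0) can be read off from its law.

Construction.  At each state i, the common mass min(mu_i, nu_i) stops at time 0.
The remaining demand f = (nu - mu)_+ is sliced into layers,
f = sum_B c_B 1_{A_B}, where every A_B contains j0 ([layer_cake]).  By symmetry
the walk started outside a set A hits A at a uniformly distributed point
([en_route_uniform]); sending the amount c_B |A_B| of surplus mass to the first
visit of A_B therefore fills this layer and no other.  The surplus lives where
f vanishes, hence outside the sets A_B.  The set to be hit is drawn at time 0
from U and X_0 ([random_choice_exists]), and the resulting hitting time stops in
j0 always, because every target contains j0 ([optimal_transport]).

Existence.  The infimum defining H ranges over probability spaces, so at least
one space with a chain and an independent uniform variable must be produced:
[chain_exists] takes the unit square, with U the first coordinate and the whole
chain decoded from the second one by nested intervals.

The remaining claims compare max_j (nu_j - mu_j) with the total variation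
distance, tested on the single set {j0}, and the Dirac masses with each other:
started at i other than i*, the excess at i* is nu_{i*}, the maximum of nu, and
no excess is larger than that when the walk starts at i*. *)

(** * Events decided by the chain and the uniform variable *)

Lemma measure_fibres d (Omega : measurableType d) (R : realType)
    (P : probability Omega R) (I : finType) (Z : Omega -> I) (A : set Omega) :
  measurable A -> (forall z, measurable (Z @^-1` [set z])) ->
  P A = (\sum_z P (A `&` Z @^-1` [set z]))%E.
Proof.
move=> mA mZ.
have -> : A = \bigcup_(z in [set: I]) (A `&` Z @^-1` [set z]).
  by rewrite -setI_bigcupr; apply/seteqP; split=> [w Aw|w []//];
    split=> //; exists (Z w).
rewrite measure_fin_bigcup//.
- rewrite (fsbigE (index_enum I))//= ?index_enum_uniq//.
  + rewrite [RHS](eq_bigr (fun z => P (A `&` Z @^-1` [set z])))//.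
      by apply: eq_bigl => z; rewrite in_setT.
    move=> z _; congr (P _); apply/seteqP; split=> [w [[x _ [Aw _]] ?]|w [Aw ?]].
      by split.
    by split => //; exists z.
  + by move=> i _; rewrite mem_index_enum.
- exact: finite_finset.
- by apply/trivIsetP => i j _ _ ij; apply/seteqP; split=> // w [[_ +] [_]] /= => -> /eqP;
    rewrite (negbTE ij).
- by move=> i _; exact: measurableI.
Qed.

Arguments measure_fibres {d Omega R} P {I} Z {A}.

Section Chain.
Context d (Omega : measurableType d) (R : realType) (P : probability Omega R).
Variables (S : finType) (U : {RV P >-> R}) (X : nat -> Omega -> S).
Variables (mu : S -> R) (p : S -> S -> R).
Hypotheses (chainX : markov_chain P X mu p) (indUX : indep_UX U X).

Definition on_path (t : nat) (x : nat -> S) : set Omega :=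
  [set w | forall s, (s <= t)%N -> X s w = x s].

Lemma measurable_fibre t x : measurable (X t @^-1` [set x]).
Proof. by case: chainX. Qed.

Lemma measurable_state t (Y : set S) : measurable (X t @^-1` Y).
Proof.
have -> : X t @^-1` Y = \bigcup_(y in Y) (X t @^-1` [set y]).
  by apply/seteqP; split=> [w Yw|w [y Yy /= ->]//]; exists (X t w).
by apply: fin_bigcup_measurable => [|y _]; [exact: finite_finset|
  exact: measurable_fibre].
Qed.

Lemma measurable_filtration t E : filtration U X t E -> measurable E.
Proof.
apply: smallest_sub; first exact: sigma_algebra_measurable.
move=> _ [[B mB <-]|[s _ [Y _ <-]]]; first exact: measurable_funPT.
by rewrite setTI; exact: measurable_state.
Qed.

Lemma filtrationC t E : filtration U X t E -> filtration U X t (~` E).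
Proof. by rewrite -setTD; exact: sigma_algebraCD. Qed.

Lemma filtrationU t E F : filtration U X t E -> filtration U X t F ->
  filtration U X t (E `|` F).
Proof.
move=> hE hF; rewrite -bigcup2E; apply: sigma_algebra_bigcup => -[|[|k]] //=.
exact: sigma_algebra0.
Qed.

Lemma filtrationI t E F : filtration U X t E -> filtration U X t F ->
  filtration U X t (E `&` F).
Proof.
move=> hE hF; rewrite -[_ `&` _]setCK setCI.
by apply: filtrationC; apply: filtrationU; exact: filtrationC.
Qed.

Lemma filtration_bigcup t (I : countType) (E : I -> set Omega) :
  (forall i, filtration U X t (E i)) -> filtration U X t (\bigcup_i E i).
Proof.
move=> hE; have -> : \bigcup_i E i =
    \bigcup_m (if unpickle m is Some i then E i else set0).
  apply/seteqP; split=> w [i _]; first by exists (pickle i); rewrite ?pickleK.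
  by case: unpickle => // j; exists j.
apply: sigma_algebra_bigcup => m; case: unpickle => //.
exact: sigma_algebra0.
Qed.

Lemma filtration_state t s (Y : set S) : (s <= t)%N ->
  filtration U X t (X s @^-1` Y).
Proof.
move=> st; apply: sub_sigma_algebra; right; exists s => //.
by exists Y => //; rewrite setTI.
Qed.

Lemma filtration_uniform t (B : set R) : measurable B ->
  filtration U X t (U @^-1` B).
Proof.
by move=> mB; apply: sub_sigma_algebra; left; exists B => //; rewrite setTI.
Qed.

Lemma sub_filtration s t : (s <= t)%N -> filtration U X s `<=` filtration U X t.
Proof.
move=> st; apply: sub_sigma_algebra2 => E [?|[r /= rs ?]]; [by left|right].
by exists r => //=; exact: leq_trans st.
Qed.

(** Once the path up to time t is prescribed, the only information left in an
event known at time t is about U.  This property is stable under the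
sigma-algebra operations and holds for the generators; it lets the independence
of U and X act on one path at a time. *)
Lemma filtration_on_path t E (x : nat -> S) : filtration U X t E ->
  exists2 B, <<s gen_U U >> B & E `&` on_path t x = B `&` on_path t x.
Proof.
move: E; apply: smallest_sub; first split.
- by exists set0 => //; exact: sigma_algebra0.
- move=> E [B gB EB]; exists (setT `\` B); first exact: sigma_algebraCD.
  apply/seteqP; split=> w [[_ nE] xw]; split=> //; split=> // h.
    by have [] : (E `&` on_path t x) w by rewrite EB.
  by have [] : (B `&` on_path t x) w by rewrite -EB.
- move=> F hF; have [G hG] := choice (fun k => (exists2P _ _).1 (hF k)).
  exists (\bigcup_k G k).
    by apply: sigma_algebra_bigcup => k; have [] := hG k.
  by rewrite !setI_bigcupl; apply: eq_bigcupr => k _; have [] := hG k.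
- move=> E [gE|[s /= st [Y _ <-]]].
    by exists E => //; exact: sub_sigma_algebra.
  rewrite setTI; have [Yx|nYx] := pselect (Y (x s)).
    exists setT.
      rewrite -[X in _ X](setD0 setT); apply: sigma_algebraCD.
      exact: sigma_algebra0.
    rewrite setTI; apply/seteqP; split=> w; first by case.
    by move=> xw; split=> //=; rewrite xw.
  exists set0; first exact: sigma_algebra0.
  rewrite set0I; apply/seteqP; split=> w // -[] /= + xw.
  by rewrite xw.
Qed.

Lemma on_path_sigma t x : <<s \bigcup_s gen_X X s >> (on_path t x).
Proof.
have -> : on_path t x = ~` \bigcup_s
    (if (s <= t)%N then X s @^-1` (~` [set x s]) else set0).
  apply/seteqP; split=> w.
    by move=> xw [s _]; case: ifP => // st; apply; exact: xw.
  move=> nw s st; apply: contrapT => xs; apply: nw; exists s => //.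
  by rewrite st.
rewrite -setTD; apply: sigma_algebraCD; apply: sigma_algebra_bigcup => s.
case: ifP => _; last exact: sigma_algebra0.
apply: sub_sigma_algebra; exists s => //; exists (~` [set x s]) => //.
by rewrite setTI.
Qed.

(** On a single path, the event depends on U alone, and U is independent of the
whole chain, so the factor P(U event) goes through the Markov equation. *)
Lemma markov_on_path t E (x : nat -> S) j : filtration U X t E ->
  P (E `&` on_path t x `&` X t.+1 @^-1` [set j]) =
  (P (E `&` on_path t x) * (p (x t) j)%:E)%E.
Proof.
move=> /(filtration_on_path x) [B gB ->].
pose y s := if (s <= t)%N then x s else j.
have pathE s : (s <= t)%N -> y s = x s by rewrite /y => ->.
have yt : y t.+1 = j by rewrite /y ltnn.
have -> : B `&` on_path t x `&` X t.+1 @^-1` [set j] = B `&` on_path t.+1 y.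
  apply/seteqP; split=> w.
    case=> -[Bw xw] /= jw; split=> // s; rewrite leq_eqVlt => /predU1P[->|].
      by rewrite yt.
    by rewrite ltnS => st; rewrite pathE ?xw.
  move=> [Bw yw]; split; first split=> //.
    by move=> s st; rewrite -pathE ?yw// leqW.
  by rewrite /= yw.
have -> : on_path t x = on_path t y.
  by apply/seteqP; split=> w xw s st; rewrite xw// pathE.
rewrite !indUX//; [|exact: on_path_sigma..].
case: chainX => _ _ ->; rewrite yt pathE//; exact: muleA.
Qed.

(** The chain stays Markov when U is added to its past, so randomization gives no
foresight: sum [markov_on_path] over the finitely many paths up to time t. *)
Lemma markov_from t E i j : filtration U X t E -> E `<=` X t @^-1` [set i] ->
  P (E `&` X t.+1 @^-1` [set j]) = (P E * (p i j)%:E)%E.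
Proof.
move=> hE Ei; have mE := measurable_filtration hE.
pose Z w := [ffun s : 'I_t.+1 => X s w].
pose x (f : {ffun 'I_t.+1 -> S}) s := f (inord s).
have ZE f : Z @^-1` [set f] = on_path t (x f).
  apply/seteqP; split=> w.
    by move=> <- s st; rewrite /x ffunE inordK.
  by move=> xw; apply/ffunP => s; rewrite ffunE xw ?/x ?inord_val// -ltnS.
have mZ f : measurable (Z @^-1` [set f]).
  rewrite ZE; have -> : on_path t (x f) =
      \bigcap_(s in `I_t.+1) (X s @^-1` [set x f s]).
    by apply/seteqP; split=> w h s /= st; exact: h.
  by apply: fin_bigcap_measurable => // s _; exact: measurable_fibre.
rewrite (measure_fibres P Z)//; last first.
  by apply: measurableI => //; exact: measurable_fibre.
rewrite [P E](measure_fibres P Z)//.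
rewrite ge0_sume_distrl//; apply: eq_bigr => f _.
rewrite ZE setIAC markov_on_path//.
have [<-//|ne] := eqVneq (x f t) i.
suff -> : E `&` on_path t (x f) = set0 by rewrite measure0 !mul0e.
apply/seteqP; split=> // w [/Ei /= Xi xw].
by move: ne; rewrite -Xi xw ?eqxx.
Qed.

Lemma markov_step t E j : filtration U X t E ->
  P (E `&` X t.+1 @^-1` [set j]) =
  (\sum_i P (E `&` X t @^-1` [set i]) * (p i j)%:E)%E.
Proof.
move=> hE; rewrite (measure_fibres P (X t))//.
- apply: eq_bigr => i _; rewrite setIAC (markov_from (i := i))//.
  by apply: filtrationI => //; exact: filtration_state.
- by apply: measurableI; [exact: measurable_filtration hE|exact: measurable_fibre].
- exact: measurable_fibre.
Qed.

(** * Expectation and stopped law as series over time *)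

Section Time.
Variable T : Omega -> option nat.
Hypothesis stopT : stopping_time U X T.

Definition stopped_by (t : nat) : set Omega :=
  [set w | exists2 s, (s <= t)%N & T w = Some s].

Lemma measurable_stopped_by t : measurable (stopped_by t).
Proof. exact: measurable_filtration (@stopT t). Qed.

Lemma filtration_running t : filtration U X t (~` stopped_by t).
Proof. exact: filtrationC (@stopT t). Qed.

Lemma measurable_running t : measurable (~` stopped_by t).
Proof. exact: measurable_filtration (@filtration_running t). Qed.

Lemma series_running w :
  (if T w is Some t then t%:R%:E else +oo%E : \bar R) =
  (\sum_(0 <= t <oo) (\1_(~` stopped_by t) w)%:E)%E.
Proof.
have E1 t : (forall s, (s <= t)%N -> T w <> Some s) ->
    (\1_(~` stopped_by t) w)%:E = 1%E :> \bar R.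
  move=> h; rewrite indicE mem_set// => -[s st /h]; exact.
case E : (T w) => [t|].
  rewrite (nneseries_split 0 t)// add0n eseries0 ?adde0.
    rewrite big_nat (eq_bigr (fun=> 1%E)); last first.
      move=> s st; apply: E1 => r rs; rewrite E => -[tr].
      by move: rs; rewrite -tr leqNgt (andP st).2.
    by rewrite -big_nat sumEFin sumr_const_nat subn0.
  move=> s ts _; rewrite indicE memNset//; apply; exists t => //.
apply/esym/eqyP => A _.
pose k := (Num.truncn A).+1.
have /le_trans : ((A : R)%:E <= \sum_(0 <= t < k) (\1_(~` stopped_by t) w)%:E)%E.
  rewrite (eq_bigr (fun=> 1%E)); last by move=> t _; apply: E1 => s _; rewrite E.
  by rewrite sumEFin sumr_const_nat subn0 lee_fin ltW// Num.Theory.truncnS_gt.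
by apply; apply: nneseries_lim_ge => t _ _; rewrite lee_fin.
Qed.

(** The tail formula E[T] = sum_t P(T > t). *)
Lemma expected_time_series :
  expected_time P T = (\sum_(0 <= t <oo) P (~` stopped_by t))%E.
Proof.
rewrite /expected_time (eq_integral _ _ (fun w _ => series_running w)).
rewrite integral_nneseries//; last first.
  move=> t; apply/measurable_EFinP; exact: measurable_indic (measurable_running t).
by apply: eq_eseriesr => t _; rewrite integral_indic// ?setIT//;
  exact: measurable_running.
Qed.

(** The walk stops in j by being there at time 0 or by arriving there at a time
t+1 which is the first one at which T has occurred.  The event F makes the same
decomposition available on a part of the sample space. *)
Lemma stopped_at_series (F : set Omega) j : measurable F ->
  P (F `&` [set w | exists2 t, T w = Some t & X t w = j]) =
  (P (F `&` stopped_by 0 `&` X 0%N @^-1` [set j]) +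
   \sum_(0 <= t <oo) P (F `&` ~` stopped_by t `&` stopped_by t.+1
                           `&` X t.+1 @^-1` [set j]))%E.
Proof.
move=> mF; pose at_ t := [set w | T w = Some t].
have at0 : at_ 0%N = stopped_by 0.
  apply/seteqP; split=> w; first by exists 0%N.
  by case=> s; rewrite leqn0 => /eqP ->.
have atS t : at_ t.+1 = ~` stopped_by t `&` stopped_by t.+1.
  apply/seteqP; split=> w.
    move=> Tw; split; last by exists t.+1.
    by case=> s st; rewrite Tw => -[ts]; rewrite -ts ltnn in st.
  case=> nT [s]; rewrite leq_eqVlt => /predU1P[->//|st Tw].
  by case: nT; exists s.
have mat t : measurable (at_ t).
  case: t => [|t]; first by rewrite at0; exact: measurable_stopped_by.
  rewrite atS; apply: measurableI; first exact: measurable_running.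
  exact: measurable_stopped_by.
pose G t := F `&` at_ t `&` X t @^-1` [set j].
have mG t : measurable (G t).
  by do !apply: measurableI => //; exact: measurable_fibre.
have -> : F `&` [set w | exists2 t, T w = Some t & X t w = j] = \bigcup_t G t.
  apply/seteqP; split=> w.
    by case=> Fw [t Tw Xw]; exists t.
  by move=> [t _ [[Fw Tw] Xw]]; split=> //; exists t.
rewrite measure_semi_bigcup//; last first.
- by apply: bigcup_measurable => t _; exact: mG.
- apply/trivIsetP => s t _ _ /eqP st; apply/seteqP; split=> // w.
  by move=> [[[_ sw] _] [[_ tw] _]]; apply: st; case: (etrans (esym sw) tw).
rewrite nneseries_recl//.
rewrite -(nneseries_addn 1)//.
rewrite /G at0; congr (_ + _)%E.
by apply: eq_eseriesr => t _; rewrite addn1 atS setIA.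
Qed.

End Time.

End Chain.

Arguments filtrationC {d Omega R P S U X} t {E} _ _ _.
Arguments filtrationU {d Omega R P S U X} t {E F} _ _ _ _.
Arguments filtrationI {d Omega R P S U X} t {E F} _ _ _ _.
Arguments filtration_state {d Omega R P S} U X {t s} Y _ _ _.
Arguments filtration_uniform {d Omega R P S U} X t {B} _ _ _.
Arguments filtration_running {d Omega R P S U X T} stopT t _ _.
Arguments filtration_bigcup {d Omega R P S U X} t {I E} _ _ _.

(** * Stopping times of the walk on the complete graph *)

Section CompleteWalk.
Context d (Omega : measurableType d) (R : realType) (P : probability Omega R).
Variables (n : nat) (U : {RV P >-> R}) (X : nat -> Omega -> 'I_n.+1).
Variable mu : 'I_n.+1 -> R.
Hypothesis n_gt0 : (0 < n)%N.
Hypothesis chainX : markov_chain P X mu (@complete_walk R n).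
Hypothesis indUX : indep_UX U X.

Let nV_ge0 : 0 <= n%:R^-1 :> R. Proof. by rewrite invr_ge0. Qed.

Lemma walk_step_le t E j : filtration U X t E ->
  (P (E `&` X t.+1 @^-1` [set j]) <= n%:R^-1%:E * P E)%E.
Proof.
move=> hE; rewrite (markov_step chainX indUX)//.
rewrite [P E](measure_fibres P (X t)); last 2 first.
- exact: (measurable_filtration chainX hE).
- exact: (measurable_fibre chainX).
rewrite ge0_sume_distrr//; apply: lee_sum => i _.
rewrite [leRHS]muleC lee_wpmul2l// lee_fin /complete_walk.
by case: ifP.
Qed.

Lemma walk_step_eq t E j : filtration U X t E -> (forall w, E w -> X t w <> j) ->
  P (E `&` X t.+1 @^-1` [set j]) = (n%:R^-1%:E * P E)%E.
Proof.
move=> hE Ej; rewrite (markov_step chainX indUX)//.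
rewrite [P E](measure_fibres P (X t)); last 2 first.
- exact: (measurable_filtration chainX hE).
- exact: (measurable_fibre chainX).
rewrite ge0_sume_distrr//; apply: eq_bigr => i _.
rewrite [RHS]muleC /complete_walk; case: eqVneq => // ->.
suff -> : E `&` X t @^-1` [set j] = set0 by rewrite measure0 !mul0e.
by apply/seteqP; split=> // w [/Ej].
Qed.

Section Time.
Variable T : Omega -> option nat.
Hypothesis stopT : stopping_time U X T.

Let stopped_at j := [set w | exists2 t, T w = Some t & X t w = j].

Let at_seriesT j :
  P (stopped_at j) =
  (P (stopped_by T 0 `&` X 0%N @^-1` [set j]) +
   \sum_(0 <= t <oo) P (~` stopped_by T t `&` stopped_by T t.+1
                           `&` X t.+1 @^-1` [set j]))%E.
Proof.
have := stopped_at_series chainX stopT j measurableT.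
by rewrite !setTI => ->; congr (_ + _)%E; apply: eq_eseriesr => t _; rewrite setTI.
Qed.

(** Bound each arrival at j at time t+1 by P(T > t)/n and sum with the tail
formula. *)
Lemma stopped_at_le j :
  (P (stopped_at j) <= (mu j)%:E + n%:R^-1%:E * expected_time P T)%E.
Proof.
rewrite at_seriesT (expected_time_series chainX stopT).
have [_ <- _] := chainX; apply: leeD.
  apply: le_measure; rewrite ?inE//; last exact: (measurable_fibre chainX).
  apply: measurableI; last exact: (measurable_fibre chainX).
  exact: (measurable_stopped_by chainX stopT).
rewrite -nneseriesZl//; apply: lee_nneseries => // t _.
apply: le_trans (walk_step_le j (filtration_running stopT t)).
rewrite le_measure ?inE//; last by move=> w [[]].
- apply: measurableI; last exact: (measurable_fibre chainX).
  by apply: measurableI; [exact: (measurable_running chainX stopT)|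
    exact: (measurable_stopped_by chainX stopT)].
- by apply: measurableI; [exact: (measurable_running chainX stopT)|
    exact: (measurable_fibre chainX)].
Qed.

(** If being in j forces T to have occurred, then a running walk is never in j,
so it moves to j with probability exactly 1/n, and it stops as it arrives: both
inequalities behind [stopped_at_le] become equalities. *)
Lemma stopped_at_eq j : (forall w t, X t w = j -> stopped_by T t w) ->
  P (stopped_at j) = ((mu j)%:E + n%:R^-1%:E * expected_time P T)%E.
Proof.
move=> hitj; rewrite at_seriesT (expected_time_series chainX stopT).
have [_ <- _] := chainX; congr (P _ + _)%E.
  by apply/seteqP; split=> w; [case|split=> //; exact: hitj].
rewrite -nneseriesZl//; apply: eq_eseriesr => t _.
rewrite -(walk_step_eq (j := j) (filtration_running stopT t)); last first.
  by move=> w rw Xj; apply: rw; exact: hitj.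
congr (P _); apply/seteqP; split=> w; first by case=> -[].
by move=> [rw Xw]; split=> //; split=> //; exact: hitj.
Qed.

(** Each P(T > t) is at least P(T = infinity), so the tail formula would diverge
if T were infinite with positive probability. *)
Lemma finite_expected_as_finite : (expected_time P T < +oo)%E -> as_finite P T.
Proof.
move=> ET.
pose N := [set w | T w = None].
have NE : N = \bigcap_t ~` stopped_by T t.
  apply/seteqP; split=> w.
    by move=> Tw t _ [s _]; rewrite Tw.
  move=> h; apply/eqP; case E : (T w) => [t|//].
  by exfalso; apply: (h t) => //; exists t.
have mN : measurable N.
  by rewrite NE; apply: bigcap_measurable => // t _;
    exact: (measurable_running chainX stopT).
exists N; split=> //; last by move=> w /= /contrapT.
apply/eqP; apply: contraTT ET => PN; rewrite -leNgt leye_eq.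
rewrite (expected_time_series chainX stopT); apply/eqP/eqyP => A _.
have Nle t : (P N <= P (~` stopped_by T t))%E.
  rewrite le_measure ?inE//; first exact: (measurable_running chainX stopT).
  by rewrite NE => w; apply.
have PNgt : 0 < fine (P N).
  by rewrite fine_gt0// measure_gt0 PN /= -ge0_fin_numE ?fin_num_measure.
pose k := (Num.truncn ((A : R) / fine (P N))).+1.
have /le_trans : ((A : R)%:E <= \sum_(0 <= t < k) P (~` stopped_by T t))%E.
  apply: (@le_trans _ _ (\sum_(0 <= t < k) (P N))%E); last exact: lee_sum.
  rewrite -(@fineK _ (P N)) ?fin_num_measure// sumEFin sumr_const_nat subn0 lee_fin.
  by rewrite -[leRHS]mulr_natl -ler_pdivrMr// ltW// Num.Theory.truncnS_gt.
by apply; apply: nneseries_lim_ge.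
Qed.

End Time.

Lemma walk_time_ge nu T j : stopping_time U X T -> stopped_law P X T nu ->
  ((n%:R * (nu j - mu j))%:E <= expected_time P T)%E.
Proof.
move=> stopT lawT; have := stopped_at_le stopT j; rewrite lawT.
have : (0 <= expected_time P T)%E.
  by apply: integral_ge0 => w _; case: (T w) => // t; rewrite lee_fin.
case: (expected_time P T) => [e|_ _|//]; last by rewrite leey.
move=> e0; rewrite -EFinM -EFinD !lee_fin => h.
by rewrite mulrC -ler_pdivlMr ?ltr0n// lerBlDl mulrC.
Qed.

End CompleteWalk.

(** * Hitting times of a random target *)

Lemma big_option (R : Type) (idx : R) (op : Monoid.com_law idx) (I : finType)
    (F : option I -> R) :
  \big[op/idx]_z F z = op (F None) (\big[op/idx]_i F (Some i)).
Proof.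
rewrite (bigD1 None)//=; congr (op _ _).
rewrite (reindex_omap Some id)//=; last by case.
by apply: eq_bigl => i; rewrite eqxx.
Qed.

Definition first_time (Y : nat -> bool) : option nat :=
  if pselect (exists t, Y t) is left h then Some (ex_minn h) else None.

Lemma first_time_hit Y t : first_time Y = Some t -> Y t.
Proof.
by rewrite /first_time; case: pselect => // h [<-]; case: ex_minnP.
Qed.

Lemma first_time_le (Y : nat -> bool) t : Y t ->
  exists2 s, (s <= t)%N & first_time Y = Some s.
Proof.
move=> Yt; rewrite /first_time; case: pselect => [h|]; last by case; exists t.
by exists (ex_minn h) => //; case: ex_minnP => m _ /(_ _ Yt).
Qed.

(** Throughout, the target set A_K is drawn at time 0 and every possible target
contains the state j0.  The matrix [law] is the joint law of X_0 and K. *)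
Section Hitting.
Context d (Omega : measurableType d) (R : realType) (P : probability Omega R).
Variables (n : nat) (U : {RV P >-> R}) (X : nat -> Omega -> 'I_n.+1).
Variable mu : 'I_n.+1 -> R.
Hypothesis n_gt0 : (0 < n)%N.
Hypothesis chainX : markov_chain P X mu (@complete_walk R n).
Hypothesis indUX : indep_UX U X.
Variables (I : finType) (K : Omega -> I) (A : I -> {set 'I_n.+1}).
Variables (j0 : 'I_n.+1) (law : 'I_n.+1 -> I -> R).
Hypothesis j0A : forall k, j0 \in A k.
Hypothesis filtrK : forall k, filtration U X 0 (K @^-1` [set k]).
Hypothesis lawK : forall i k,
  P (X 0%N @^-1` [set i] `&` K @^-1` [set k]) = (law i k)%:E.

Definition hit_time (w : Omega) : option nat :=
  first_time (fun t => X t w \in A (K w)).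

Local Notation T := hit_time.

Lemma hit_stopped_by t w :
  stopped_by T t w <-> exists2 s, (s <= t)%N & X s w \in A (K w).
Proof.
split=> [[s st /first_time_hit h]|[s st Xs]]; first by exists s.
have [r rs Tr] := first_time_le (Y := fun t => X t w \in A (K w)) Xs.
by exists r => //; exact: leq_trans st.
Qed.

Lemma stopping_hit_time : stopping_time U X T.
Proof.
move=> t; rewrite -/(stopped_by T t).
have -> : stopped_by T t = \bigcup_(i : nat * I)
    if (i.1 <= t)%N then X i.1 @^-1` [set` A i.2] `&` K @^-1` [set i.2] else set0.
  apply/seteqP; split=> w.
    by move=> /hit_stopped_by[s st Xs]; exists (s, K w); rewrite ?st.
  move=> [[s k] _ /=]; case: ifP => // st [/= Xs Kw].
  by apply/hit_stopped_by; exists s => //; rewrite Kw.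
apply: filtration_bigcup => -[s k] /=; case: ifP => st; last exact: sigma_algebra0.
apply: filtrationI; first exact: filtration_state.
by apply: sub_filtration (filtrK k).
Qed.

Let stopT := stopping_hit_time.

Let stopped_at j := [set w | exists2 t, T w = Some t & X t w = j].

(** Every target contains j0, so j0 is never visited without stopping. *)
Lemma stopped_at_hit_time :
  P (stopped_at j0) = ((mu j0)%:E + n%:R^-1%:E * expected_time P T)%E.
Proof.
apply: (stopped_at_eq chainX indUX stopT) => w t Xj.
by apply/hit_stopped_by; exists t => //; rewrite Xj.
Qed.

Lemma measurable_stopped_at j : measurable (stopped_at j).
Proof.
have -> : stopped_at j = \bigcup_t (stopped_by T t `&` X t @^-1` [set j]
    `&` \bigcap_(s in `I_t) ~` stopped_by T s).
  apply/seteqP; split=> w.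
    move=> [t Tw Xt]; exists t => //; split; first split => //.
      by exists t.
    by move=> s /= st [r rs]; rewrite Tw => -[tr]; move: st; rewrite tr ltnNge rs.
  move=> [t _ [[[s st Ts] Xt] nst]]; exists t => //.
  move: st; rewrite leq_eqVlt => /predU1P[<-//|st].
  by exfalso; apply: (nst s st); exists s.
apply: bigcup_measurable => t _; apply: measurableI; first apply: measurableI.
- exact: (measurable_stopped_by chainX stopT).
- exact: (measurable_fibre chainX).
- apply: fin_bigcap_measurable => // s _.
  exact: (measurable_running chainX stopT).
Qed.

(** The identity of [stopped_at_hit_time] bounds E[T]/n by a probability. *)
Lemma expected_hit_time_lty : (expected_time P T < +oo)%E.
Proof.
have : (P (stopped_at j0) < +oo)%E.
  apply: le_lt_trans (ltry 1); apply: probability_le1.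
  exact: measurable_stopped_at.
rewrite stopped_at_hit_time; rewrite !ltey; apply: contraNN => /eqP ->.
by rewrite gt0_muley ?lte_fin ?invr_gt0 ?ltr0n// addey.
Qed.

Lemma as_finite_hit_time : as_finite P T.
Proof. exact: (finite_expected_as_finite chainX stopT expected_hit_time_lty). Qed.

Definition en_route k : set Omega :=
  K @^-1` [set k] `&` ~` stopped_by T 0.

Lemma filtration_K t k : filtration U X t (K @^-1` [set k]).
Proof. exact: sub_filtration (filtrK k). Qed.

Lemma measurable_K k : measurable (K @^-1` [set k]).
Proof. exact: (measurable_filtration chainX (@filtration_K 0 k)). Qed.

Lemma measurable_en_route k : measurable (en_route k).
Proof.
apply: measurableI; first exact: measurable_K.
exact: (measurable_running chainX stopT).
Qed.

(** The value on the right does not depend on j inside the target: this is the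
symmetry of the complete graph, seen step by step. *)
Lemma en_route_stopped_at k j : P (en_route k `&` stopped_at j) =
  if j \in A k then
    (n%:R^-1%:E * \sum_(0 <= t <oo) P (K @^-1` [set k] `&` ~` stopped_by T t))%E
  else 0%E.
Proof.
rewrite (stopped_at_series chainX stopT j (measurable_en_route k)).
rewrite (_ : en_route k `&` stopped_by T 0 = set0) ?set0I ?measure0 ?add0e; last first.
  by apply/seteqP; split=> // w [[]].
have E t : en_route k `&` ~` stopped_by T t `&` stopped_by T t.+1
      `&` X t.+1 @^-1` [set j] =
    if j \in A k then K @^-1` [set k] `&` ~` stopped_by T t `&` X t.+1 @^-1` [set j]
    else set0.
  apply/seteqP; split=> w.
    move=> [[[[/= Kw n0] nt] /hit_stopped_by[s st Xs]] Xj].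
    suff -> : j \in A k by [].
    move: st; rewrite leq_eqVlt => /predU1P[st|st]; first by rewrite -Xj -Kw -st.
    by exfalso; apply: nt; apply/hit_stopped_by; exists s.
  case: ifP => // jA [[Kw nt] Xj]; split=> //; split; last first.
    by apply/hit_stopped_by; exists t.+1 => //; rewrite Xj Kw.
  split=> //; split=> // /hit_stopped_by[s s0 Xs]; apply: nt.
  by apply/hit_stopped_by; exists s => //; exact: leq_trans s0 _.
rewrite (eq_eseriesr (fun t _ => congr1 P (E t))).
case: ifP => jA; last by rewrite eseries0// => t _ _; rewrite measure0.
rewrite -nneseriesZl//; apply: eq_eseriesr => t _.
apply: (walk_step_eq chainX indUX).
  apply: filtrationI; first exact: filtration_K.
  exact: filtration_running.
move=> w [/= Kw nt] Xj; apply: nt; apply/hit_stopped_by; exists t => //.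
by rewrite Xj Kw.
Qed.

(** The hitting time is almost surely finite, so no mass is lost. *)
Lemma en_route_split k :
  P (en_route k) = (\sum_j P (en_route k `&` stopped_at j))%E.
Proof.
pose Z w := if T w is Some t then Some (X t w) else None.
have ZS j : Z @^-1` [set Some j] = stopped_at j.
  apply/seteqP; split=> w; rewrite /Z /= /stopped_at /=.
    by case: (T w) => // t [<-]; exists t.
  by case=> t -> ->.
have ZN : Z @^-1` [set None] = \bigcap_t ~` stopped_by T t.
  apply/seteqP; split=> w; rewrite /Z /=.
    by case E : (T w) => // _ t _ [s _]; rewrite E.
  case E : (T w) => [t|//] h; exfalso; apply: (h t) => //.
  by exists t.
have mN : measurable (Z @^-1` [set None]).
  rewrite ZN; apply: bigcap_measurable => // t _.
  exact: (measurable_running chainX stopT).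
rewrite (measure_fibres P Z); first last.
- by case=> [j|//]; rewrite ZS; exact: measurable_stopped_at.
- exact: measurable_en_route.
suff N0 : P (en_route k `&` Z @^-1` [set None]) = 0%E.
  by rewrite big_option /= N0 add0e; apply: eq_bigr => j _; rewrite ZS.
have [N [mN' PN0 sN]] := as_finite_hit_time.
apply: (subset_measure0 (B := N)) => //.
  by apply: measurableI => //; exact: measurable_en_route.
move=> w [_]; rewrite /Z /= => Zw; apply: sN => /=; apply.
by move: Zw; case: (T w).
Qed.

(** Equal shares ([en_route_stopped_at]) that add up to the whole
([en_route_split]). *)
Lemma en_route_uniform k j : P (en_route k `&` stopped_at j) =
  ((j \in A k)%:R / #|A k|%:R * fine (P (en_route k)))%:E.
Proof.
have Ek := en_route_split k; rewrite en_route_stopped_at.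
case: ifP => jA; last by rewrite mulr0n !mul0r.
set c := (_ * _)%E.
have cE : c = P (en_route k `&` stopped_at j) by rewrite en_route_stopped_at jA.
have cfin : c \is a fin_num.
  rewrite cE fin_num_measure//; apply: measurableI; first exact: measurable_en_route.
  exact: measurable_stopped_at.
have -> : P (en_route k) = (\sum_(i in A k) c)%E.
  rewrite Ek [RHS]big_mkcond/=; apply: eq_bigr => i _.
  by rewrite en_route_stopped_at.
rewrite -(fineK cfin) sumEFin /= sumr_const mul1r -[X in _ * X]mulr_natl mulKf//.
by rewrite pnatr_eq0 -lt0n; apply/card_gt0P; exists j.
Qed.

Lemma en_route_mass k :
  P (en_route k) = (\sum_(i | i \notin A k) law i k)%:E.
Proof.
rewrite (measure_fibres P (X 0%N)); first last.
- exact: (measurable_fibre chainX).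
- exact: measurable_en_route.
rewrite -sumEFin [RHS]big_mkcond; apply: eq_bigr => i _; rewrite -lawK.
have R0 w : stopped_by T 0 w <-> X 0%N w \in A (K w).
  split=> [/hit_stopped_by[s]|]; first by rewrite leqn0 => /eqP ->.
  by move=> h; apply/hit_stopped_by; exists 0%N.
case: ifPn => iA.
  congr (P _); apply/seteqP; split=> w; first by case=> -[].
  move=> [/= Xi Kw]; split=> //; split=> // /R0.
  by rewrite Xi Kw (negbTE iA).
rewrite (_ : _ `&` _ = set0) ?measure0//; apply/seteqP; split=> // w.
by move=> [[/= Kw n0] Xi]; apply: n0; apply/R0; rewrite Xi Kw; apply/negPn.
Qed.

(** The first term is the mass that starts in j with j in its target and stops at
time 0; the second one is an equal share of the mass that starts outside. *)
Lemma hit_law j : P (stopped_at j) =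
  (\sum_(k | j \in A k)
     (law j k + (\sum_(i | i \notin A k) law i k) / #|A k|%:R))%:E.
Proof.
rewrite (measure_fibres P K); first last.
- exact: measurable_K.
- exact: measurable_stopped_at.
rewrite -sumEFin [RHS]big_mkcond; apply: eq_bigr => k _.
have m1 : measurable (stopped_at j `&` K @^-1` [set k]).
  by apply: measurableI; [exact: measurable_stopped_at|exact: measurable_K].
have -> : P (stopped_at j `&` K @^-1` [set k]) =
    (P (stopped_at j `&` K @^-1` [set k] `&` stopped_by T 0) +
     P (en_route k `&` stopped_at j))%E.
  rewrite -[X in P X = _](setIT _) -(setUv (stopped_by T 0)) setIUr measureU.
  - by congr (_ + P _)%E; rewrite -setIA setIC.
  - by apply: measurableI => //; exact: (measurable_stopped_by chainX stopT).
  - by apply: measurableI => //; exact: (measurable_running chainX stopT).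
  - by apply/seteqP; split=> // w [[_ ?] []].
rewrite en_route_uniform en_route_mass /=.
have -> : P (stopped_at j `&` K @^-1` [set k] `&` stopped_by T 0) =
    if j \in A k then (law j k)%:E else 0%E.
  case: ifPn => jA.
    rewrite -lawK; congr (P _); apply/seteqP; split=> w.
      move=> [[[t Tw Xt] Kw] [s]]; rewrite leqn0 => /eqP -> Tw0.
      by move: Tw Xt; rewrite Tw0 => -[<-].
    move=> [/= Xj Kw].
    have [s] : exists2 s, (s <= 0)%N & T w = Some s.
      by apply: (first_time_le (Y := fun t => X t w \in A (K w))); rewrite Xj Kw.
    rewrite leqn0 => /eqP -> Tw0; split; last by exists 0%N.
    by split=> //; exists 0%N.
  rewrite (_ : _ `&` _ = set0) ?measure0//; apply/seteqP; split=> // w.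
  move=> [[[t Tw Xt] /= Kw] _]; move/negP: jA; apply.
  by have := first_time_hit Tw; rewrite Xt Kw.
case: ifP => jA; last by rewrite mul0r mul0r adde0.
by rewrite -EFinD mul1r mulrC.
Qed.

End Hitting.

(** * A chain decoded from a uniform number *)

(** A finite distribution q cuts the unit interval into consecutive half-open
intervals of lengths q x; the function F gives their left end points and Q tells
in which one a number lies. *)
Lemma quantile_exists (R : realType) (S : finType) (q : S -> R) : is_distr q ->
  exists (Q : R -> S) (F : S -> R),
    (forall x, 0 <= F x /\ F x + q x <= 1) /\
    forall r : R, 0 <= r < 1 -> forall x, Q r = x <-> F x <= r < F x + q x.
Proof.
move=> [q0 q1].
pose G k := \sum_(y | (enum_rank y < k)%N) q y.
have Gmono k l : (k <= l)%N -> G k <= G l.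
  move=> kl; rewrite /G [leRHS]big_mkcond [leLHS]big_mkcond/=.
  apply: ler_sum => y _; case: ifP => [yk|_]; last by case: ifP.
  by rewrite (leq_trans yk kl).
have GS x : G (enum_rank x).+1 = G (enum_rank x) + q x.
  rewrite /G (bigD1 x)//= addrC; congr (_ + _); apply: eq_bigl => y.
  rewrite ltnS leq_eqVlt (inj_eq val_inj) (inj_eq enum_rank_inj).
  by case: eqVneq => [->|_]; rewrite ?ltnn ?andbT.
have GT : G #|S| = 1 by rewrite -q1; apply: eq_bigl => y; rewrite ltn_ord.
have G0 : G 0%N = 0 by rewrite /G big_pred0.
have /card_gt0P[x0 _] : (0 < #|S|)%N.
  by rewrite lt0n; apply: contra_eq_neq GT => ->; rewrite G0 eq_sym oner_eq0.
pose F (x : S) := G (enum_rank x).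
have Fex (r : R) : 0 <= r < 1 -> exists x, F x <= r < F x + q x.
  move=> /andP[r0 r1].
  have ex : exists k, r < G k by exists #|S|; rewrite GT.
  case: (ex_minnP ex) => -[|k]; first by rewrite G0 ltNge r0.
  move=> rk kmin; have kS : (k < #|S|)%N.
    by apply: kmin; rewrite GT.
  exists (enum_val (Ordinal kS)); rewrite /F -GS enum_valK /= rk andbT.
  by rewrite leNgt; apply/negP => /kmin; rewrite ltnn.
pose Q (r : R) := odflt x0 [pick x | F x <= r < F x + q x].
exists Q, F; split=> [x|r rI x].
  split; first by rewrite -G0; exact: Gmono.
  by rewrite -GS -GT; apply: Gmono; exact: ltn_ord.
have uniqF y z : F y <= r < F y + q y -> F z <= r < F z + q z ->
    (enum_rank y <= enum_rank z)%N.
  move=> /andP[yr _] /andP[_ rz]; rewrite leqNgt; apply/negP => /Gmono.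
  by rewrite GS leNgt (le_lt_trans yr rz).
rewrite /Q; case: pickP => [y yr|none] /=; last first.
  by have [y] := Fex _ rI; rewrite none.
split=> [<-//|xr]; apply: enum_rank_inj; apply/val_inj/eqP.
by rewrite eqn_leq !uniqF.
Qed.

Section Coding.
Context (R : realType) (S : finType) (mu : S -> R) (p : S -> S -> R).
Variables (Q0 : R -> S) (F0 : S -> R) (Q : S -> R -> S) (F : S -> S -> R).
Hypothesis mu0 : forall x, 0 <= mu x.
Hypothesis p0 : forall x y, 0 <= p x y.
Hypothesis F0I : forall x, 0 <= F0 x /\ F0 x + mu x <= 1.
Hypothesis Q0P : forall r : R, 0 <= r < 1 ->
  forall x, Q0 r = x <-> F0 x <= r < F0 x + mu x.
Hypothesis FI : forall i x, 0 <= F i x /\ F i x + p i x <= 1.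
Hypothesis QP : forall i (r : R), 0 <= r < 1 ->
  forall x, Q i r = x <-> F i x <= r < F i x + p i x.

(** The state is read from the interval that contains v; the position of v inside
this interval, rescaled to [0, 1), is the number from which the next state is
read.  On [0, 1) the weight divided by is the length of a nonempty interval, hence
positive. *)
Fixpoint coding (t : nat) (v : R) : S * R :=
  if t is s.+1 then
    let: (y, r) := coding s v in
    let x := Q y r in (x, (r - F y x) / p y x)
  else let x := Q0 v in (x, (v - F0 x) / mu x).

Fixpoint path_weight (t : nat) (x : nat -> S) : R :=
  if t is s.+1 then path_weight s x * p (x s) (x t) else mu (x 0%N).

Lemma path_weight_ge0 t x : 0 <= path_weight t x.
Proof. by elim: t => //= t IH; rewrite mulr_ge0. Qed.

(** The numbers that produce a given initial path form an interval whose length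
is the probability of the path, and the rescaled position is affine on it. *)
Lemma coding_cylinder t x : exists a : R, [/\ 0 <= a, a + path_weight t x <= 1 &
  forall v : R, 0 <= v < 1 ->
    ((forall s, (s <= t)%N -> (coding s v).1 = x s) <->
       a <= v < a + path_weight t x) /\
    (a <= v < a + path_weight t x ->
       (coding t v).2 = (v - a) / path_weight t x)].
Proof.
elim: t => [|t [a [a0 a1 IH]]].
  have [h0 h1] := F0I (x 0%N).
  exists (F0 (x 0%N)); split=> // v vI; split.
    by rewrite -Q0P//=; split=> [h|h [|]//]; exact: (h 0%N).
  by move=> /(Q0P vI) /= ->.
have [h0 h1] := FI (x t) (x t.+1).
set L := path_weight t x in a1 IH *.
have L0 : 0 <= L := path_weight_ge0 t x.
set f := F _ _ in h0 h1; set q := p _ _ in h1.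
have q_ge0 : 0 <= q by exact: p0.
have -> : path_weight t.+1 x = L * q by [].
exists (a + L * f); split; first by rewrite addr_ge0// mulr_ge0.
  rewrite -addrA -mulrDr (le_trans _ a1)// lerD2l.
  by rewrite -[leRHS]mulr1 ler_wpM2l.
move=> v vI; have [IHp IHr] := IH v vI.
have sub : a + L * f <= v < a + L * f + L * q -> a <= v < a + L.
  move=> /andP[av va]; apply/andP; split.
    by apply: le_trans av; rewrite lerDl mulr_ge0.
  apply: lt_le_trans va _; rewrite -addrA -mulrDr lerD2l.
  by rewrite -[leRHS]mulr1 ler_wpM2l.
have key : a <= v < a + L -> (forall s, (s <= t)%N -> (coding s v).1 = x s) ->
    ((coding t.+1 v).1 = x t.+1 <-> a + L * f <= v < a + L * f + L * q) /\
    (a + L * f <= v < a + L * f + L * q ->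
       (coding t.+1 v).2 = (v - (a + L * f)) / (L * q)).
  move=> vL xv; have := IHr vL; have := xv t (leqnn t) => /=.
  case: (coding t v) => y r /= -> ->.
  have Lgt0 : 0 < L.
    by move: vL => /andP[av]; rewrite -ltrBlDl; apply: le_lt_trans; rewrite subr_ge0.
  have rI : 0 <= (v - a) / L < 1.
    move: vL => /andP[av va]; rewrite divr_ge0 ?subr_ge0//=.
    by rewrite ltr_pdivrMr// mul1r ltrBlDl.
  have E : f <= (v - a) / L < f + q = (a + L * f <= v < a + L * f + L * q).
    rewrite ler_pdivlMr// ltr_pdivrMr// lerBrDl ltrBlDl.
    by rewrite [f * L]mulrC [(f + q) * L]mulrC mulrDr addrA.
  split; first by rewrite QP// E.
  rewrite -E => /(QP _ rI) ->; rewrite -/f -/q invfM mulrA; congr (_ / _).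
  by rewrite opprD addrA [RHS]mulrBl mulrAC divff ?mul1r// gt_eqF.
split; last first.
  move=> vJ; have vL := sub vJ; have [_ ->]// := key vL (IHp.2 vL).
split=> [xv|vJ].
  have xv' s : (s <= t)%N -> (coding s v).1 = x s by move=> st; apply/xv/leqW.
  by have [<- _] := key (IHp.1 xv') xv'; exact: xv.
move=> s; have vL := sub vJ; have xv := IHp.2 vL.
rewrite leq_eqVlt => /predU1P[->|]; last by rewrite ltnS => /xv.
by have [-> _] := key vL xv.
Qed.

End Coding.

Section Clip.
Variable R : realType.
Local Notation lam := (uniform_prob (@ltr01 R)).

Lemma uniform_prob_itvco (a b : R) : 0 <= a -> a <= b -> b <= 1 ->
  lam `[a, b[%classic = (b - a)%:E.
Proof.
move=> a0 ab b1; rewrite /uniform_prob integral_uniform_pdf.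
rewrite (_ : _ `&` _ = `[a, b[%classic); last first.
  apply/seteqP; split=> v /=; rewrite !in_itv/=; first by case.
  move=> /andP[av vb]; rewrite av vb (le_trans a0 av); split=> //.
  by rewrite ltW// (lt_le_trans vb).
rewrite (eq_integral (fun=> 1%E)); last first.
  move=> v; rewrite inE/= in_itv/= => /andP[av vb]; rewrite /uniform_pdf.
  by rewrite (le_trans a0 av) (ltW (lt_le_trans vb b1)) subr0 invr1.
rewrite integral_cst//= mul1e lebesgue_measure_itv/= lte_fin.
by case: ltgtP ab => [|//|->]; rewrite ?subrr// EFinB.
Qed.

(** Numbers are decoded on [0, 1) only; the null set outside is sent to 0 so that
the decoded variables are defined and measurable everywhere. *)
Definition clip (v : R) : R := if 0 <= v < 1 then v else 0.

Lemma clipI v : 0 <= clip v < 1.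
Proof. by rewrite /clip; case: ifP => // _; rewrite lexx ltr01. Qed.

Lemma clip_preimage (a b : R) : 0 <= a -> b <= 1 ->
  clip @^-1` `[a, b[%classic =
  `[a, b[%classic `|` (if a <= 0 < b then ~` `[0, 1[%classic else set0).
Proof.
move=> a0 b1; apply/seteqP; split=> v /=.
  rewrite /clip; case: ifP => [_|v01]; first by left.
  rewrite in_itv/= => ->; right => /=; rewrite in_itv/= => h.
  by rewrite h in v01.
case=> [|].
  rewrite in_itv/= => /andP[av vb]; rewrite /clip (le_trans a0 av).
  by rewrite (lt_le_trans vb b1)/= in_itv/= av.
case: ifP => // ab; rewrite /= in_itv/= => /negP/negbTE v01.
by rewrite /clip v01 in_itv.
Qed.

Lemma measurable_clip_preimage (a b : R) : 0 <= a -> b <= 1 ->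
  measurable (clip @^-1` `[a, b[%classic).
Proof.
move=> a0 b1; rewrite clip_preimage//; apply: measurableU => //.
by case: ifP => // _; exact: measurableC.
Qed.

Lemma uniform_clip (a b : R) : 0 <= a -> a <= b -> b <= 1 ->
  lam (clip @^-1` `[a, b[%classic) = (b - a)%:E.
Proof.
move=> a0 ab b1; rewrite clip_preimage//.
set J := if _ then _ else _.
have mJ : measurable J by rewrite /J; case: ifP => // _; exact: measurableC.
have aJ : `[a, b[%classic `&` J = set0.
  rewrite /J; case: ifP => _; last by rewrite setI0.
  apply/seteqP; split=> // v [/=]; rewrite !in_itv/= => /andP[av vb].
  by rewrite (le_trans a0 av) (lt_le_trans vb b1).
transitivity (lam `[a, b[%classic + lam J)%E; first exact: measureU.
rewrite uniform_prob_itvco// [X in (_ + X)%E](_ : _ = 0%E) ?adde0// /J.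
case: ifP => _; last by rewrite measure0.
rewrite probability_setC// [X in (1 - X)%E](_ : _ = 1%E) ?subee//.
by apply: etrans (uniform_prob_itvco (lexx 0) ler01 (lexx 1)) _; rewrite subr0.
Qed.

End Clip.

(** On the unit square, U is the first coordinate and the chain is decoded from
the second one, so that their independence is the product structure. *)
Lemma chain_exists (R : realType) (S : finType) (mu : S -> R) (p : S -> S -> R) :
  is_distr mu -> (forall i, is_distr (p i)) ->
  exists (d : measure_display) (Omega : measurableType d)
    (P : probability Omega R) (U : {RV P >-> R}) (X : nat -> Omega -> S),
    [/\ markov_chain P X mu p, uniform01 U & indep_UX U X].
Proof.
move=> dmu dp.
have [Q0 [F0 [F0I Q0P]]] := quantile_exists dmu.
have [Q hQ] := choice (fun i => quantile_exists (dp i)).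
have [F hF] := choice hQ.
pose lam := uniform_prob (@ltr01 R).
pose Omega := (measurableTypeR R * measurableTypeR R)%type.
pose P : probability Omega R := (uniform_prob (@ltr01 R) \x uniform_prob (@ltr01 R))%E.
have mfst : measurable_fun [set: Omega] (fst : Omega -> R).
  by move=> _ B mB; exact: (@measurable_fst _ _ (measurableTypeR R) (measurableTypeR R)).
pose U : {RV P >-> R} := HB.pack (fst : Omega -> R) (isMeasurableFun.Build _ _ _ _ _ mfst).
pose Y t (v : measurableTypeR R) : S := (coding mu p Q0 F0 Q F t (clip v)).1.
pose X t (w : Omega) : S := Y t w.2.
have mu0 x : 0 <= mu x by case: dmu.
have p0 x y : 0 <= p x y by have [] := dp x.
have PX (A B : set (measurableTypeR R)) : measurable A -> measurable B ->
    P (A `*` B) = (lam A * lam B)%E by move=> mA mB; exact: product_measure1E.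
have lamT : lam setT = 1%E by exact: probability_setT.
pose cyl t x := [set v | forall s, (s <= t)%N -> Y s v = x s].
have cylE t x : exists a : R, [/\ 0 <= a, a + path_weight mu p t x <= 1 &
    cyl t x = clip (R := R) @^-1` `[a, a + path_weight mu p t x[%classic].
  have [a [a0 a1 ha]] := coding_cylinder mu0 p0 F0I Q0P
    (fun i => (hF i).1) (fun i => (hF i).2) t x.
  exists a; split=> //; apply/seteqP; split=> v /=; rewrite in_itv/=.
    by move=> h; apply/(ha _ (clipI v)).1.
  by move=> /(ha _ (clipI v)).1.
have mcyl t x : measurable (cyl t x).
  by have [a [a0 a1 ->]] := cylE t x; exact: measurable_clip_preimage.
have Pcyl t x : P [set w | forall s, (s <= t)%N -> X s w = x s] =
    (path_weight mu p t x)%:E.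
  have -> : [set w | forall s, (s <= t)%N -> X s w = x s] = setT `*` cyl t x.
    by apply/seteqP; split=> w; [|case].
  rewrite PX// lamT mul1e; have [a [a0 a1 ->]] := cylE t x.
  by rewrite /lam uniform_clip// ?lerDl ?path_weight_ge0// addrC addKr.
have mY t (Z : set S) : measurable (Y t @^-1` Z).
  have -> : Y t @^-1` Z = \bigcup_(f in [set f : {ffun 'I_t.+1 -> S} |
      Z (f ord_max)]) cyl t (fun s => f (inord s)).
    have max_t : inord t = ord_max :> 'I_t.+1.
      by apply: val_inj; rewrite /= inordK.
    apply/seteqP; split=> v /=.
      move=> Zv; exists [ffun s : 'I_t.+1 => Y s v] => /=; first by rewrite ffunE.
      by move=> s st; rewrite ffunE inordK.
    by move=> [f /= Zf /(_ t (leqnn t)) ->]; rewrite max_t.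
  by apply: fin_bigcup_measurable => [|f _]; [exact: finite_finset|exact: mcyl].
have snd_preimage (C : set (measurableTypeR R)) :
    snd @^-1` C = [set: measurableTypeR R] `*` C.
  by apply/seteqP; split=> w //= -[].
have fst_preimage (B : set (measurableTypeR R)) :
    fst @^-1` B = B `*` [set: measurableTypeR R].
  by apply/seteqP; split=> w //= -[].
exists _, Omega, P, U, X; split.
- split=> [t x|x|t x].
  + rewrite (_ : X t @^-1` _ = snd @^-1` (Y t @^-1` [set x]))//.
    by rewrite snd_preimage; exact: measurableX.
  + rewrite -[RHS](Pcyl 0%N (fun=> x)); congr (P _).
    by apply/seteqP; split=> w /= h; [case|exact: h].
  + by rewrite !Pcyl -EFinM.
- by move=> B mB; rewrite [U @^-1` B]fst_preimage PX// lamT mule1.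
- have sU : <<s gen_U U >> `<=` preimage_set_system setT fst (@measurable _ (measurableTypeR R)).
    apply: smallest_sub; first exact/sigma_algebra_preimage/sigma_algebra_measurable.
    by move=> _ [B mB <-]; exists B.
  have sX : <<s \bigcup_s gen_X X s >> `<=`
      preimage_set_system setT snd (@measurable _ (measurableTypeR R)).
    apply: smallest_sub; first exact/sigma_algebra_preimage/sigma_algebra_measurable.
    by move=> _ [s _ [Z _ <-]]; exists (Y s @^-1` Z).
  move=> _ _ /sU[B mB <-] /sX[C mC <-].
  rewrite !setTI [fst @^-1` B `&` _](_ : _ = B `*` C)//.
  by rewrite fst_preimage snd_preimage !PX// lamT mul1e mule1.
Qed.

(** * The optimal stopping time *)

(** Peel off the largest constant multiple of the indicator of the support of f:
the support shrinks, and j0, where f is maximal, leaves it last.  Layers are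
indexed by arbitrary sets B, and j0 is added to the index so that every layer
contains it by construction. *)
Lemma layer_cake (R : realType) (S : finType) (f : S -> R) (j0 : S) :
  (forall i, 0 <= f i <= f j0) ->
  exists c : {set S} -> R, (forall B, 0 <= c B) /\
    forall j, f j = \sum_(B | j \in j0 |: B) c B.
Proof.
have [m] := ubnP #|[set i | 0 < f i]%SET|; elim: m f => // m IH f fm fI.
have f0 i : 0 <= f i by have /andP[] := fI i.
have fle i : f i <= f j0 by have /andP[] := fI i.
have [fj0|fj0] := leP (f j0) 0.
  exists (fun=> 0); split=> // j; rewrite big1//.
  by apply/eqP; rewrite eq_le f0 (le_trans (fle j)).
set B0 := [set i | 0 < f i]%SET in fm.
have j0B : j0 \in B0 by rewrite inE.
case: (arg_minP f j0B) => i0 i0B i0min.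
have {}i0B : i0 \in B0 by [].
have {}i0min j : j \in B0 -> f i0 <= f j by exact: i0min.
pose f' i := f i - (i \in B0)%:R * f i0.
have f'I i : 0 <= f' i <= f' j0.
  rewrite /f' j0B mul1r; case: (boolP (i \in B0)) => iB.
    by rewrite mul1r subr_ge0 i0min// lerD2r fle.
  rewrite mul0r subr0 f0/= (_ : f i = 0) ?subr_ge0//.
  by apply/eqP; rewrite eq_le f0 andbT leNgt; move: iB; rewrite inE.
have [|c [c0 fc]] := IH f' _ f'I.
  rewrite -ltnS (leq_trans _ fm)// ltnS; apply: proper_card.
  apply/properP; split; last first.
    by exists i0 => //; rewrite inE /f' i0B mul1r subrr ltxx.
  apply/fintype.subsetP => i; rewrite !inE /f'; apply: contraTT => fi.
  rewrite -leNgt; apply: le_trans (_ : f i <= 0); last by rewrite leNgt.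
  by rewrite gerBl mulr_ge0.
exists (fun B => c B + (B == B0)%:R * f i0); split=> [B|j].
  by rewrite addr_ge0// mulr_ge0.
have -> : f j = f' j + (j \in B0)%:R * f i0 by rewrite /f' subrK.
rewrite big_split/= -fc -mulr_suml; congr (_ + _ * _).
rewrite big_mkcond (bigD1 B0)//= eqxx big1 ?addr0.
  have -> : j0 |: B0 = B0 by apply/finset.setUidPr; rewrite finset.sub1set.
  by case: ifP.
by move=> B /negbTE ->; case: ifP.
Qed.

(** Any joint law with first marginal the law of X_0 is realized by a variable
known at time 0: apply to U the quantile function of the conditional law given
X_0.  The value k0 only serves at states of mass 0, where that conditional law
is arbitrary. *)
Lemma random_choice_exists d (Omega : measurableType d) (R : realType)
    (P : probability Omega R) (S I : finType) (U : {RV P >-> R})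
    (X : nat -> Omega -> S) (mu : S -> R) (p : S -> S -> R)
    (law : S -> I -> R) (k0 : I) :
  markov_chain P X mu p -> uniform01 U -> indep_UX U X ->
  (forall i k, 0 <= law i k) -> (forall i, \sum_k law i k = mu i) ->
  exists K : Omega -> I,
    (forall k, filtration U X 0 (K @^-1` [set k])) /\
    forall i k, P (X 0%N @^-1` [set i] `&` K @^-1` [set k]) = (law i k)%:E.
Proof.
move=> chainX unifU indUX law0 lawS.
pose q i k := if mu i == 0 then dirac_mass R k0 k else law i k / mu i.
have mu0 i : 0 <= mu i by rewrite -lawS sumr_ge0.
have dq i : is_distr (q i).
  split=> [k|]; rewrite /q; case: eqP => [_|/eqP mui].
  - by rewrite ler0n.
  - by rewrite divr_ge0.
  - by rewrite (bigD1 k0)//= /dirac_mass eqxx big1 ?addr0// => k /negbTE ->.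
  - by rewrite -mulr_suml lawS divff.
have muq i k : mu i * q i k = law i k.
  rewrite /q; case: eqP => [mui|/eqP mui]; last by rewrite mulrCA divff ?mulr1.
  rewrite mui mul0r; apply/esym/(psumr_eq0P (P := xpredT)) => //.
  by rewrite lawS.
have [Q hQ] := choice (fun i => quantile_exists (dq i)).
have [F hF] := choice hQ.
pose B i k := clip (R := R) @^-1` `[F i k, F i k + q i k[%classic.
have FI i k : 0 <= F i k /\ F i k + q i k <= 1 by have [] := hF i.
have mB i k : measurable (B i k).
  by have [F0 F1] := FI i k; exact: measurable_clip_preimage.
exists (fun w => Q (X 0%N w) (clip (U w))).
have KE k w : Q (X 0%N w) (clip (U w)) = k <-> B (X 0%N w) k (U w).
  have [_ /(_ _ (clipI (U w)) k) ->] := hF (X 0%N w).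
  by rewrite /B /= in_itv.
split=> [k|i k].
  have -> : (fun w => Q (X 0%N w) (clip (U w))) @^-1` [set k] =
      \bigcup_i (X 0%N @^-1` [set i] `&` U @^-1` B i k).
    apply/seteqP; split=> w; first by move=> /KE Bw; exists (X 0%N w).
    by move=> [i _ [/= <- Bw]]; exact/KE.
  apply: filtration_bigcup => i; apply: filtrationI; first exact: filtration_state.
  exact: filtration_uniform.
have -> : X 0%N @^-1` [set i] `&` (fun w => Q (X 0%N w) (clip (U w))) @^-1` [set k] =
    U @^-1` B i k `&` X 0%N @^-1` [set i].
  apply/seteqP; split=> w; first by move=> [/= <- /KE].
  by move=> [Bw /= Xi]; split=> //; apply/KE; rewrite Xi.
rewrite indUX; first last.
- apply: sub_sigma_algebra; exists 0%N => //; exists [set i] => //.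
  by rewrite setTI.
- by apply: sub_sigma_algebra; exists (B i k) => //; rewrite setTI.
have [_ -> _] := chainX.
have [F0 F1] := FI i k; have [q0 _] := dq i.
rewrite unifU// (@uniform_clip R) ?lerDl// -EFinM addrC addKr.
by rewrite mulrC muq.
Qed.

Lemma is_distr_complete_walk (R : realType) n (i : 'I_n.+1) : (0 < n)%N ->
  is_distr (@complete_walk R n i).
Proof.
move=> n0; split=> [j|]; rewrite /complete_walk.
  by case: ifP => // _; rewrite invr_ge0.
rewrite (bigD1 i)//= eqxx add0r (eq_bigr (fun=> n%:R^-1)); last first.
  by move=> j; rewrite eq_sym => /negbTE ->.
rewrite sumr_const -[X in _ *+ X](_ : n = _).
  by rewrite -[LHS]mulr_natl divff// pnatr_eq0 -lt0n.
by have := cardC1 i; rewrite card_ord.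
Qed.

(** The target None is the whole space, which stops the mass common to mu and nu
at time 0; the target Some B is the layer B of the demand, and it receives
surplus mass in proportion to its total demand c_B |A_B|. *)
Lemma optimal_transport (R : realType) n (mu nu : 'I_n.+1 -> R) j0 :
  (0 < n)%N -> is_distr mu -> is_distr nu ->
  (forall j, nu j - mu j <= nu j0 - mu j0) ->
  transport_cost (@complete_walk R n) mu nu (n%:R * (nu j0 - mu j0))%:E.
Proof.
move=> n0 dmu dnu j0max.
have [mu0 mu1] := dmu; have [nu0 nu1] := dnu.
pose common i := Num.min (mu i) (nu i).
pose surplus i := mu i - common i.
pose f j := nu j - common j.
have common_ge0 i : 0 <= common i by rewrite le_min mu0 nu0.
have surplus_ge0 i : 0 <= surplus i by rewrite subr_ge0 ge_min lexx.
have f_ge0 j : 0 <= f j by rewrite subr_ge0 ge_min lexx orbT.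
have fE j : f j = Num.max (nu j - mu j) 0.
  by rewrite /f /common; case: (leP (mu j) (nu j)) => h;
    [rewrite max_l ?subr_ge0|rewrite subrr max_r ?subr_le0// ltW].
have [c [c0 fc]] : exists c : {set 'I_n.+1} -> R, (forall B, 0 <= c B) /\
    forall j, f j = \sum_(B | j \in j0 |: B) c B.
  apply: layer_cake => i; rewrite f_ge0/= !fE.
  by rewrite ge_max !le_max j0max lexx orbT.
pose m := \sum_i surplus i.
have mE : \sum_j f j = m.
  by rewrite /m /f /surplus !sumrB nu1 mu1.
have m_ge0 : 0 <= m by exact: sumr_ge0.
have mcE : \sum_B c B * #|j0 |: B|%:R = m.
  rewrite -mE (eq_bigr (fun j => \sum_(B | j \in j0 |: B) c B)); last by [].
  rewrite (exchange_big_dep xpredT)//=; apply: eq_bigr => B _.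
  by rewrite sumr_const mulr_natr.
(* Surplus and demand are never both positive at a state. *)
have disj i B : i \in j0 |: B -> surplus i * c B = 0.
  move=> iB; have : surplus i * f i = 0.
    rewrite /surplus /f /common; case: (leP (mu i) (nu i)) => _.
      by rewrite subrr mul0r.
    by rewrite subrr mulr0.
  move=> /eqP; rewrite mulf_eq0 => /orP[/eqP ->|/eqP fi]; first by rewrite mul0r.
  by move: fi; rewrite fc => /psumr_eq0P -> //; rewrite mulr0.
(* When m = 0 every c_B vanishes, so the division by m is harmless. *)
have mV B : m * (c B * #|j0 |: B|%:R / m) = c B * #|j0 |: B|%:R.
  have [m00|mN0] := eqVneq m 0; last by rewrite mulrCA divff ?mulr1.
  rewrite m00 mul0r; apply/esym.
  by move: mcE; rewrite m00 => /psumr_eq0P -> // ? _; rewrite mulr_ge0.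
pose A (k : option {set 'I_n.+1}) := if k is Some B then j0 |: B else [set: 'I_n.+1]%SET.
pose law i k := if k is Some B then surplus i * (c B * #|j0 |: B|%:R / m) else common i.
have law_ge0 i k : 0 <= law i k.
  by case: k => [B|] //=; rewrite mulr_ge0// divr_ge0// mulr_ge0.
have law_sum i : \sum_k law i k = mu i.
  rewrite big_option /= -mulr_sumr -mulr_suml mcE.
  have [m00|mN0] := eqVneq m 0; last by rewrite divff// mulr1 /surplus addrC subrK.
  have := m00; rewrite /m => /psumr_eq0P h; rewrite h// mul0r addr0.
  by apply/eqP; rewrite -subr_eq0 -oppr_eq0 opprB; apply/eqP; exact: h.
have [dsp [Om [P [U [X [chainX unifU indUX]]]]]] :=
  chain_exists dmu (fun i => is_distr_complete_walk R i n0).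
have [K [filtrK lawK]] := random_choice_exists None chainX unifU indUX law_ge0 law_sum.
have j0A k : j0 \in A k by case: k => [B|]; rewrite !inE ?eqxx.
pose T := hit_time X K A.
have stopT : stopping_time U X T by exact: stopping_hit_time.
have lawT : stopped_law P X T nu.
  move=> j; rewrite (hit_law n0 chainX indUX j0A filtrK lawK); congr EFin.
  rewrite big_mkcond big_option /= inE [X in _ + X / _]big1 ?mul0r ?addr0; last first.
    by move=> i; rewrite inE.
  rewrite -big_mkcond/=.
  rewrite (eq_bigr c) => [|B jB]; first by rewrite -fc addrC subrK.
  rewrite mulrA [surplus j * _]mulrA disj// !mul0r add0r.
  have -> : \sum_(i | i \notin j0 |: B) surplus i * (c B * #|j0 |: B|%:R / m) =
      m * (c B * #|j0 |: B|%:R / m).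
    rewrite /m mulr_suml [RHS](bigID (mem (j0 |: B)))/= [X in X + _]big1 ?add0r//.
    by move=> i iB; rewrite -mulrA mulrA disj ?mul0r.
  rewrite mV mulfK// pnatr_eq0 -lt0n; apply/card_gt0P.
  by exists j0; rewrite !inE eqxx.
exists dsp, Om, P, U, X, T; do 2!split=> //.
  exact: (as_finite_hit_time n0 chainX indUX j0A filtrK).
have lt := expected_hit_time_lty n0 chainX indUX j0A filtrK.
have := stopped_at_hit_time chainX indUX j0A filtrK; rewrite -/T lawT.
have : (0 <= expected_time P T)%E.
  by apply: integral_ge0 => w _; case: (T w) => // t; rewrite lee_fin.
move: lt; rewrite -/T; case: (expected_time P T) => [e _ _| |]//.
rewrite -EFinM -EFinD => -[->]; congr EFin.
by rewrite addrC addKr mulrA divff ?mul1r// pnatr_eq0 -lt0n.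
Qed.

(** * The access time and its bounds *)

Lemma max_excess_eq (R : realType) n (mu nu : 'I_n.+1 -> R) j0 :
  (forall j, nu j - mu j <= nu j0 - mu j0) ->
  max_excess mu nu = nu j0 - mu j0.
Proof.
move=> j0max; apply/eqP; rewrite eq_le /max_excess; apply/andP; split.
  exact: bigmax_le.
exact: (le_bigmax _ (fun j => nu j - mu j)).
Qed.

Lemma max_excess_attained (R : realType) n (mu nu : 'I_n.+1 -> R) :
  exists j0, forall j, nu j - mu j <= nu j0 - mu j0.
Proof.
case: (@arg_maxP _ _ _ ord0 xpredT (fun j => nu j - mu j) isT) => j0 _ j0max.
by exists j0 => j; exact: j0max.
Qed.

Lemma access_time_eq (R : realType) n (mu nu : 'I_n.+1 -> R) :
  (0 < n)%N -> is_distr mu -> is_distr nu ->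
  access_time (@complete_walk R n) mu nu = (n%:R * max_excess mu nu)%:E.
Proof.
move=> n0 dmu dnu; have [j0 j0max] := max_excess_attained mu nu.
rewrite (max_excess_eq j0max); apply/eqP; rewrite eq_le; apply/andP; split.
  by apply: ereal_inf_lbound; exact: optimal_transport.
apply/ereal_infP => _ [d [Om [P [U [X [T [[chainX _ indUX] [stopT _ lawT ->]]]]]]]].
exact: (walk_time_ge n0 chainX indUX _ stopT lawT).
Qed.

Lemma is_distr_dirac_mass (R : realType) (S : finType) (i : S) :
  is_distr (dirac_mass R i).
Proof.
split=> [j|]; first by rewrite ler0n.
by rewrite (bigD1 i)//= /dirac_mass eqxx big1 ?addr0// => j /negbTE ->.
Qed.

Section MaxExcess.
Variables (R : realType) (n : nat) (mu nu : 'I_n.+1 -> R).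
Hypotheses (dmu : is_distr mu) (dnu : is_distr nu).

Lemma le_max_excess j : nu j - mu j <= max_excess mu nu.
Proof. exact: (le_bigmax _ (fun j => nu j - mu j)). Qed.

Lemma max_excess_ge0 : 0 <= max_excess mu nu.
Proof.
have [_ mu1] := dmu; have [_ nu1] := dnu.
have : \sum_j (nu j - mu j) <= \sum_(j < n.+1) max_excess mu nu.
  by apply: ler_sum => j _; exact: le_max_excess.
by rewrite sumrB [X in X - _]nu1 mu1 subrr sumr_const card_ord pmulrn_lge0.
Qed.

Lemma tv_distance_ub (A : {set 'I_n.+1}) : `|\sum_(i in A) mu i - \sum_(i in A) nu i| <= 1.
Proof.
have sum01 (q : 'I_n.+1 -> R) : is_distr q -> 0 <= \sum_(i in A) q i <= 1.
  move=> [q0 <-]; rewrite sumr_ge0//= [leRHS](bigID (mem A))/= lerDl.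
  exact: sumr_ge0.
have /andP[a0 a1] := sum01 _ dmu; have /andP[b0 b1] := sum01 _ dnu.
by rewrite ler_norml; apply/andP; split; lra.
Qed.

Lemma tv_dist_le1 : tv_dist mu nu <= 1.
Proof.
apply: ge_sup; first by exists 0, finset.set0 => //; rewrite !big_set0 subrr normr0.
by move=> _ [A _ <-]; exact: tv_distance_ub.
Qed.

Lemma max_excess_le_tv_dist : max_excess mu nu <= tv_dist mu nu.
Proof.
have [j0 j0max] := max_excess_attained mu nu; rewrite (max_excess_eq j0max).
apply: (@le_trans _ _ `|\sum_(i in [set j0]%SET) mu i - \sum_(i in [set j0]%SET) nu i|).
  by rewrite !big_set1 distrC ler_norm.
apply: ub_le_sup; last by exists [set j0]%SET.
by exists 1 => _ [A _ <-]; exact: tv_distance_ub.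
Qed.

End MaxExcess.

Theorem theorem2p5 (R : realType) :
  (forall (n : nat) (mu nu : 'I_n.+1 -> R),
     (1 <= n)%N -> is_distr mu -> is_distr nu ->
     let H := access_time (@complete_walk R n) in
     [/\ H mu nu = (n%:R * max_excess mu nu)%:E,
         forall j : 'I_n.+1,
           [/\ ((n%:R * Num.max (nu j - mu j) 0)%:E <= H mu nu)%E,
               (H mu nu <= (n%:R * tv_dist mu nu)%:E)%E
             & n%:R * tv_dist mu nu <= n%:R]
       & forall istar : 'I_n.+1,
           (forall i, nu i <= nu istar) ->
           ereal_inf [set H rho nu | rho in dirac_masses R 'I_n.+1] =
           H (dirac_mass R istar) nu])
  /\
  (forall mu nu : forall n : nat, 'I_n.+1 -> R,
     (forall n, is_distr (mu n)) -> (forall n, is_distr (nu n)) ->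
     (fun n : nat => fine (access_time (@complete_walk R n) (mu n) (nu n)))
       =O_\oo (fun n : nat => n%:R : R)).
Proof.
split=> [n mu nu n0 dmu dnu H|mu nu dmu dnu].
  have HE rho : is_distr rho -> H rho nu = (n%:R * max_excess rho nu)%:E.
    by move=> drho; exact: access_time_eq.
  split=> [|j|istar istar_max]; first exact: HE.
    rewrite HE// !lee_fin !ler_wpM2l ?ler0n//; last 2 first.
    - exact: max_excess_le_tv_dist.
    - by rewrite ge_max le_max_excess max_excess_ge0.
    split=> //; rewrite -[leRHS]mulr1 ler_wpM2l ?ler0n//.
    exact: tv_dist_le1.
  have dd i := is_distr_dirac_mass R i.
  apply/eqP; rewrite eq_le; apply/andP; split.
    by apply: ereal_inf_lbound; exists (dirac_mass R istar) => //; exists istar.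
  apply/ereal_infP => _ [_ [i _ <-] <-].
  rewrite !HE// lee_fin ler_wpM2l ?ler0n//.
  have [<-//|i_istar] := eqVneq istar i.
  have [j jmax] := max_excess_attained (dirac_mass R istar) nu.
  rewrite (max_excess_eq jmax).
  apply: le_trans (le_max_excess (dirac_mass R i) nu istar).
  rewrite /dirac_mass (negbTE i_istar) subr0.
  by apply: le_trans (istar_max j); rewrite gerBl ler0n.
apply/eqOP; exists 1; split=> // k k1; near=> n.
have n0 : (0 < n)%N by near: n; exists 1%N.
rewrite access_time_eq//= normrM normr_nat mulrC ler_wpM2r//.
rewrite ger0_norm ?max_excess_ge0//.
apply: le_trans (max_excess_le_tv_dist (dmu n) (dnu n)) _.
exact: le_trans (tv_dist_le1 (dmu n) (dnu n)) (ltW k1).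
Unshelve. all: by end_near.
Qed.
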